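(* Let $\varphi\in[0,1)$ be irrational, and let $g:(0,+\infty)\to\mathbb{R}$ be a bounded function such that $g(t)=t^{-\alpha}$ for all $t\ge M$, where $\alpha>0$, $M>0$ are some constants. Let $f:\mathbb{C}\to\mathbb{C}$ be a bounded function such that $$\operatorname{Re}\left(f(z)\cdot e(-\varphi)\cdot\frac{\overline{z}}{|z|}\right)=-g(|z|)\qquad\text{for all } z\in\mathbb{C} \text{ with } |z|>0.$$ In addition, let $\{y(n)\}_{n\ge 1}\subset\mathbb{C}$ be a bounded sequence for which there exist constants $K>0$, $\gamma>0$ such that for all integers $n_2>n_1\ge 1$ $$\left|\sum_{n=n_1}^{n_2-1}y(n)e(-n\varphi)\right|\le K(n_2-n_1)^{1-\gamma}.$$ If $\alpha\left(1+\frac1\gamma\right)<1$, then for all $x(1)\in\mathbb{C}$ the solution $\{x(n)\}_{n\ge 1}$ of the equation $$x(n+1)=e(\varphi)x(n)+f(x(n))+y(n),\qquad n\ge 1,$$ is bounded.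
   Context: For real $t$, $e(t):=e^{2\pi i t}$. *)

(* Defs.v *)
From Stdlib Require Import Reals ZArith.
From Coquelicot Require Import Coquelicot.
Open Scope R_scope.

(** Concrete classical reals [R] of Stdlib, and Coquelicot's complex numbers
    [C] with modulus [Cmod]. *)

Definition irrational (r : R) : Prop :=
  forall p q : Z, q <> 0%Z -> r <> IZR p / IZR q.

Definition Cexp (z : C) : C :=
  (RtoC (exp (Re z)) * (RtoC (cos (Im z)) + Ci * RtoC (sin (Im z))))%C.

Definition e (t : R) : C := Cexp (RtoC (2 * PI) * Ci * RtoC t)%C.

(** A function on (0, +oo) is a total [g : R -> R] of which only the values at
    positive arguments are ever constrained or used. *)
Definition bounded_on_pos (g : R -> R) : Prop :=
  exists B : R, forall t : R, 0 < t -> Rabs (g t) <= B.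

Definition bounded_fun (f : C -> C) : Prop :=
  exists B : R, forall z : C, Cmod (f z) <= B.

(** A sequence indexed by n >= 1 is a [u : nat -> C] whose value at 0 is
    irrelevant. *)
Definition bounded_seq (u : nat -> C) : Prop :=
  exists B : R, forall n : nat, (1 <= n)%nat -> Cmod (u n) <= B.

Definition is_solution (phi : R) (f : C -> C) (y x : nat -> C) : Prop :=
  forall n : nat, (1 <= n)%nat ->
    x (S n) = (e phi * x n + f (x n) + y n)%C.

(* Main.v *)
Require Import Defs.
From Stdlib Require Import Reals Lra Lia.
From Coquelicot Require Import Coquelicot.
Open Scope R_scope.

(** In the rotating frame u(n) = e(-n phi) x(n) the equation becomes
    u(n+1) = u(n) + F(n) + p(n), where F is bounded and has radial component
    -|u|^(-alpha) once |u| is large, and where the sum of p over a block of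
    length k has modulus at most K k^(1-gamma).

    Over a block of length L, the comparison point w = u - (sum of p so far in
    the block) moves only by F, so |w|^2 changes at each step by
    2 Re(F conj w) + |F|^2, which is at most
    -2 |u|^(1-alpha) + 2 B |sum of p| + B^2 with B a bound for F: this is
    [block_descent].  Working with |w|^2 rather than with |u| avoids following
    the direction of u along the block; the tangential part of F costs B^2.

    Take a block that starts close to the circle of radius r.  If r is large
    compared with L, then |u| stays above r/2.  If moreover r^(1-alpha) is large
    compared with L, which bounds k^(1-gamma) for 1 <= k <= L, then |w|^2
    decreases by at least L r^(1-alpha) / 2 over the block.  The block sum of p
    that is added back at the end has modulus at most q = K L^(1-gamma), so it is
    absorbed when 2 r q <= L r^(1-alpha) / 2, that is, 4 K r^alpha <= L^gamma.
    Choosing r by equality here turns the other two requirements into: r is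
    large compared with L^(1+gamma).  As r is a constant times
    L^(gamma/alpha), they hold for large L as soon as
    gamma/alpha > 1 + gamma, which is the hypothesis alpha (1 + 1/gamma) < 1
    ([exists_scale]).

    With such L and r fixed, the disc of radius r is revisited at gaps of at
    most L: from well inside, the next point is still in the disc, and from near
    the boundary, the point L steps later is.  Bounded steps then bound the
    whole orbit ([bounded_of_returns]). *)

(** * Complex arithmetic *)

Lemma Cmod_sqr_add (a b : C) :
  Cmod (a + b) ^ 2 = Cmod a ^ 2 + 2 * Re (b * Cconj a)%C + Cmod b ^ 2.
Proof.
  unfold Cmod.
  rewrite !pow2_sqrt by nra.
  destruct a as [a1 a2]; destruct b as [b1 b2]; simpl; ring.
Qed.

Lemma e_polar (t : R) : e t = (cos (2 * PI * t), sin (2 * PI * t)).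
Proof.
  unfold e, Cexp, Re, Im, Ci, RtoC, Cmult, Cplus; simpl.
  set (a := 2 * PI).
  replace ((a * 0 - 0 * 1) * t - (a * 1 + 0 * 0) * 0) with 0 by ring.
  replace ((a * 0 - 0 * 1) * 0 + (a * 1 + 0 * 0) * t) with (a * t) by ring.
  rewrite exp_0. f_equal; ring.
Qed.

Lemma e_opp (t : R) : e (- t) = Cconj (e t).
Proof.
  rewrite !e_polar, Ropp_mult_distr_r_reverse, cos_neg, sin_neg. reflexivity.
Qed.

Lemma e_add (s t : R) : e (s + t) = (e s * e t)%C.
Proof.
  rewrite !e_polar, Rmult_plus_distr_l, cos_plus, sin_plus.
  unfold Cmult; simpl. f_equal; ring.
Qed.

Lemma e_0 : e 0 = RtoC 1.
Proof. rewrite e_polar, Rmult_0_r, cos_0, sin_0. reflexivity. Qed.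

Lemma e_opp_l (t : R) : (e (- t) * e t)%C = RtoC 1.
Proof. rewrite <- e_add, Rplus_opp_l. apply e_0. Qed.

Lemma Cmod_e (t : R) : Cmod (e t) = 1.
Proof.
  assert (H : Cmod (e (- t) * e t)%C = 1) by (rewrite e_opp_l; apply Cmod_1).
  rewrite Cmod_mult, e_opp, Cmod_conj in H.
  pose proof (Cmod_ge_0 (e t)). nra.
Qed.

(** * Descent over one block *)

Lemma block_sum_succ (p : nat -> C) (n k : nat) :
  (1 <= n)%nat ->
  sum_n_m p n (n + S k - 1) = (sum_n_m p n (n + k - 1) + p (n + k)%nat)%C.
Proof.
  intros Hn.
  replace (n + S k - 1)%nat with (S (n + k - 1)) by lia.
  rewrite sum_n_Sm by lia.
  replace (S (n + k - 1)) with (n + k)%nat by lia. reflexivity.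
Qed.

(** The cross term Re(F conj w), with w = u - P and P the partial sum of p over
    the block, splits into Re(F conj u), where the inward drift tau enters, and
    an error of modulus at most B D. *)
Lemma block_descent (u F p : nat -> C) (B D tau : R) (n L : nat) :
  (1 <= n)%nat ->
  (forall k, (1 <= k)%nat -> u (S k) = (u k + F k + p k)%C) ->
  (forall k, Cmod (F k) <= B) ->
  (forall k, (k < L)%nat -> Cmod (sum_n_m p n (n + k - 1)) <= D) ->
  (forall k, (k < L)%nat -> Re (F (n + k)%nat * Cconj (u (n + k)%nat))%C <= - tau) ->
  Cmod (u (n + L)%nat - sum_n_m p n (n + L - 1))%C ^ 2
    <= Cmod (u n) ^ 2 - INR L * (2 * tau - 2 * B * D - B ^ 2).
Proof.
  intros Hn Hrec HF.
  induction L as [|L IH]; intros HP Hin.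
  (* For k = 0 the upper index n + 0 - 1 is below n, as n >= 1: the sum is empty. *)
  - rewrite sum_n_m_zero by lia.
    change (@zero _) with (RtoC 0).
    replace (n + 0)%nat with n by lia.
    replace (u n - RtoC 0)%C with (u n) by ring. simpl INR. lra.
  - rewrite block_sum_succ by lia.
    replace (n + S L)%nat with (S (n + L)) by lia.
    rewrite Hrec by lia.
    specialize (IH (fun k h => HP k (Nat.lt_lt_succ_r _ _ h))
                   (fun k h => Hin k (Nat.lt_lt_succ_r _ _ h))).
    specialize (HP L (Nat.lt_succ_diag_r _)).
    specialize (Hin L (Nat.lt_succ_diag_r _)).
    specialize (HF (n + L)%nat).
    set (P := sum_n_m p n (n + L - 1)) in *.
    set (v := u (n + L)%nat) in *. set (q := p (n + L)%nat).
    set (G := F (n + L)%nat) in *.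
    replace (v + G + q - (P + q))%C with ((v - P) + G)%C by ring.
    rewrite Cmod_sqr_add.
    assert (Hsplit : Re (G * Cconj (v - P))%C
                     = Re (G * Cconj v)%C - Re (G * Cconj P)%C).
    { destruct G, v, P; simpl; ring. }
    assert (Hcross : - Re (G * Cconj P)%C <= B * D).
    { pose proof (re_le_Cmod (G * Cconj P)%C) as Hre.
      rewrite Cmod_mult, Cmod_conj in Hre.
      pose proof (Rle_abs (- Re (G * Cconj P)%C)) as Habs.
      rewrite Rabs_Ropp in Habs.
      pose proof (Rmult_le_compat _ _ _ _ (Cmod_ge_0 G) (Cmod_ge_0 P) HF HP).
      lra. }
    pose proof (Cmod_ge_0 G).
    rewrite S_INR. nra.
Qed.

(** * The choice of block length and radius *)

(** Fixing L first and solving for r gives r = (L^gamma / (4K))^(1/alpha).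
    Taking logarithms, the last inequality says that
    (gamma - alpha gamma - alpha) ln L exceeds a constant, and the coefficient
    is positive because alpha (1 + 1/gamma) < 1. *)
Lemma exists_scale (K alpha gamma : R) :
  0 < K -> 0 < alpha -> 0 < gamma -> alpha * (1 + 1 / gamma) < 1 ->
  forall A : R, 0 < A ->
  exists (L : nat) (r : R),
    (1 <= L)%nat /\ 0 < r /\
    4 * K * Rpower r alpha = Rpower (INR L) gamma /\
    A * INR L * Rpower (INR L) gamma <= r.
Proof.
  intros HK Ha Hg Hag A HA.
  set (d := gamma - alpha * gamma - alpha).
  assert (Hd : 0 < d).
  { assert (E : d = gamma * (1 - alpha * (1 + 1 / gamma))) by (unfold d; field; lra).
    rewrite E. apply Rmult_lt_0_compat; lra. }
  set (X := (alpha * ln A + ln (4 * K)) / d).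
  destruct (INR_unbounded (exp X)) as [L HL].
  assert (HL0 : 0 < INR L) by (pose proof (exp_pos X); lra).
  exists L, (exp ((gamma * ln (INR L) - ln (4 * K)) / alpha)).
  split; [ apply (INR_lt 0) in HL0; lia | ].
  split; [ apply exp_pos | ].
  split.
  - rewrite <- (exp_ln (4 * K)) at 1 by lra.
    unfold Rpower. rewrite ln_exp, <- exp_plus. f_equal. field. lra.
  - rewrite <- (exp_ln A), <- (exp_ln (INR L)) at 1 by lra.
    unfold Rpower. rewrite <- !exp_plus.
    assert (HX : X < ln (INR L)).
    { rewrite <- (ln_exp X). apply ln_increasing; [apply exp_pos | lra]. }
    assert (HXd : X * d = alpha * ln A + ln (4 * K)) by (unfold X; field; lra).
    assert (Hlt : X * d < ln (INR L) * d) by (apply Rmult_lt_compat_r; lra).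
    apply Rlt_le, exp_increasing.
    apply Rmult_lt_reg_r with alpha; [lra|].
    unfold Rdiv. rewrite (Rmult_assoc _ (/ alpha)), Rinv_l, Rmult_1_r by lra.
    unfold d in *. nra.
Qed.

(** * From recurrence to boundedness *)

Lemma Cmod_drift (u : nat -> C) (S0 : R) (n : nat) :
  (1 <= n)%nat ->
  (forall k, (1 <= k)%nat -> Cmod (u (S k) - u k)%C <= S0) ->
  forall k, Cmod (u (n + k)%nat - u n)%C <= S0 * INR k.
Proof.
  intros Hn Hs. induction k as [|k IH].
  - replace (n + 0)%nat with n by lia.
    replace (u n - u n)%C with (RtoC 0) by ring. rewrite Cmod_0. simpl; lra.
  - replace (n + S k)%nat with (S (n + k)) by lia.
    replace (u (S (n + k)) - u n)%C
      with ((u (S (n + k)) - u (n + k)%nat) + (u (n + k)%nat - u n))%C by ring.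
    eapply Rle_trans; [apply Cmod_triangle|].
    specialize (Hs (n + k)%nat ltac:(lia)). rewrite S_INR. lra.
Qed.

(** Every time n lies at most L steps after a visit to the disc of radius r. *)
Lemma bounded_of_returns (u : nat -> C) (S0 r : R) (L : nat) :
  0 <= S0 ->
  (forall k, (1 <= k)%nat -> Cmod (u (S k) - u k)%C <= S0) ->
  Cmod (u 1%nat) <= r ->
  (forall n, (1 <= n)%nat -> Cmod (u n) <= r ->
     exists k, (1 <= k <= L)%nat /\ Cmod (u (n + k)%nat) <= r) ->
  forall n, (1 <= n)%nat -> Cmod (u n) <= r + S0 * INR L.
Proof.
  intros HS Hs H1 Hret n Hn.
  assert (Hlast : exists m k, (1 <= m)%nat /\ (k <= L)%nat /\ n = (m + k)%nat /\
                              Cmod (u m) <= r).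
  { induction n as [|n IH]; [lia|].
    destruct (Nat.eq_dec n 0) as [->|Hn0].
    { exists 1%nat, 0%nat. repeat split; auto; lia. }
    destruct (IH ltac:(lia)) as (m & k & Hm & Hk & -> & Hmr).
    destruct (Nat.eq_dec k L) as [->|HkL].
    - destruct (Hret m Hm Hmr) as (j & Hj & Hjr).
      exists (m + j)%nat, (S L - j)%nat. repeat split; auto; lia.
    - exists m, (S k). repeat split; auto; lia. }
  destruct Hlast as (m & k & Hm & Hk & -> & Hmr).
  pose proof (Cmod_drift u S0 m Hm Hs k) as Hd.
  pose proof (Cmod_triangle (u (m + k)%nat - u m) (u m)) as Ht.
  replace (u (m + k)%nat - u m + u m)%C with (u (m + k)%nat) in Ht by ring.
  apply le_INR in Hk. nra.
Qed.

(** * Bounded orbits under a weak inward drift *)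

(** The statement in the rotating frame, where the rotation has disappeared and
    only the radial drift and the cancellation in block sums of p remain. *)
Lemma bounded_of_inward_drift (u F p : nat -> C) (B Y M alpha K gamma : R) :
  0 < M -> 0 < alpha -> 0 < K -> 0 < gamma -> alpha * (1 + 1 / gamma) < 1 ->
  (forall n, (1 <= n)%nat -> u (S n) = (u n + F n + p n)%C) ->
  (forall n, Cmod (F n) <= B) ->
  (forall n, (1 <= n)%nat -> Cmod (p n) <= Y) ->
  (forall n, (1 <= n)%nat -> M <= Cmod (u n) ->
     Re (F n * Cconj (u n))%C <= - Rpower (Cmod (u n)) (1 - alpha)) ->
  (forall n k, (1 <= n)%nat -> (1 <= k)%nat ->
     Cmod (sum_n_m p n (n + k - 1)) <= K * Rpower (INR k) (1 - gamma)) ->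
  bounded_seq u.
Proof.
  intros HM Ha HK Hg Hag Hrec HF Hp Hin Hsum.
  assert (HB : 0 <= B) by (pose proof (Cmod_ge_0 (F 0%nat)); specialize (HF 0%nat); lra).
  assert (HY : 0 <= Y)
    by (pose proof (Cmod_ge_0 (p 1%nat)); specialize (Hp 1%nat (le_n _)); lra).
  assert (Ha1 : alpha < 1).
  { assert (0 < alpha * (1 / gamma)).
    { apply Rmult_lt_0_compat; [lra|]. apply Rdiv_lt_0_compat; lra. }
    lra. }
  (* One constant for all the largeness requirements on r: 4 (B + Y) keeps the
     block above r/2, 2 M keeps it where the drift is known, the next term puts
     the starting point in the disc, and the last one makes the error
     2 B D + B^2 with D = K L at most half of r^(1-alpha). *)
  set (A := 4 * (B + Y) + 2 * M + Cmod (u 1%nat) + (2 * B * K + B ^ 2) / (2 * K)).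
  assert (HAq : 0 <= (2 * B * K + B ^ 2) / (2 * K)).
  { apply Rmult_le_pos; [nra|]. apply Rlt_le, Rinv_0_lt_compat; lra. }
  pose proof (Cmod_ge_0 (u 1%nat)) as Hu1.
  destruct (exists_scale K alpha gamma HK Ha Hg Hag A) as (L & r & HL & Hr & HrL & HAr).
  { unfold A; lra. }
  assert (HL1 : 1 <= INR L) by (apply (le_INR 1) in HL; exact HL).
  assert (HLg : 1 <= Rpower (INR L) gamma).
  { rewrite <- (Rpower_O (INR L)) by lra. apply Rle_Rpower; lra. }
  assert (HA4 : 0 <= A) by (unfold A; lra).
  assert (HALr : A * INR L <= r).
  { eapply Rle_trans; [|exact HAr]. rewrite <- (Rmult_1_r (A * INR L)) at 1.
    apply Rmult_le_compat_l; [nra|lra]. }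
  assert (HAr1 : A <= r) by nra.
  assert (Hr1a : Rpower r (1 - alpha) * Rpower (INR L) gamma = 4 * K * r).
  { rewrite <- HrL. replace (Rpower r (1 - alpha) * (4 * K * Rpower r alpha))
      with (4 * K * (Rpower r (1 - alpha) * Rpower r alpha)) by ring.
    rewrite <- Rpower_plus. replace (1 - alpha + alpha) with 1 by ring.
    rewrite Rpower_1; lra. }
  assert (Hcost : 2 * B * (K * INR L) + B ^ 2 <= Rpower r (1 - alpha) / 2).
  { assert (HKA : 4 * K * (A * INR L) <= Rpower r (1 - alpha)).
    { apply Rmult_le_reg_r with (Rpower (INR L) gamma); [lra|].
      rewrite Hr1a. nra. }
    assert (HA5 : (2 * B * K + B ^ 2) / (2 * K) <= A) by (unfold A; lra).
    assert (HA6 : 2 * B * K + B ^ 2 <= A * (2 * K)).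
    { apply Rmult_le_compat_r with (r := 2 * K) in HA5; [|lra].
      unfold Rdiv in HA5. rewrite Rmult_assoc, Rinv_l, Rmult_1_r in HA5; lra. }
    nra. }
  assert (Hsum' : forall n k, (1 <= n)%nat -> (k < L)%nat ->
                    Cmod (sum_n_m p n (n + k - 1)) <= K * INR L).
  { intros n k Hn Hk. destruct (Nat.eq_dec k 0) as [->|Hk0].
    - rewrite sum_n_m_zero by lia. change (@zero _) with (RtoC 0).
      rewrite Cmod_0. nra.
    - eapply Rle_trans; [apply Hsum; lia|].
      apply Rmult_le_compat_l; [lra|].
      assert (1 <= INR k) by (apply (le_INR 1); lia).
      assert (INR k <= INR L) by (apply le_INR; lia).
      apply Rle_trans with (Rpower (INR k) 1).
      + apply Rle_Rpower; lra.
      + rewrite Rpower_1; lra. }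
  assert (Hstep : forall k, (1 <= k)%nat -> Cmod (u (S k) - u k)%C <= B + Y).
  { intros k Hk. rewrite Hrec by lia.
    replace (u k + F k + p k - u k)%C with (F k + p k)%C by ring.
    eapply Rle_trans; [apply Cmod_triangle|].
    specialize (HF k); specialize (Hp k Hk); lra. }
  exists (r + (B + Y) * INR L).
  apply bounded_of_returns; [lra | exact Hstep | unfold A in HAr1; lra |].
  intros n Hn Hnr.
  destruct (Rle_lt_dec (Cmod (u n)) (r - (B + Y))) as [Hsmall | Hbig].
  { exists 1%nat. split; [lia|].
    pose proof (Cmod_drift u (B + Y) n Hn Hstep 1) as Hd.
    pose proof (Cmod_triangle (u (n + 1)%nat - u n) (u n)) as Ht.
    replace (u (n + 1)%nat - u n + u n)%C with (u (n + 1)%nat) in Ht by ring.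
    simpl INR in Hd. lra. }
  exists L. split; [lia|].
  assert (Hhalf : forall k, (k < L)%nat -> r / 2 <= Cmod (u (n + k)%nat)).
  { intros k Hk.
    pose proof (Cmod_drift u (B + Y) n Hn Hstep k) as Hd.
    pose proof (Cmod_triangle (- (u (n + k)%nat - u n)) (u (n + k)%nat)) as Ht.
    replace (- (u (n + k)%nat - u n) + u (n + k)%nat)%C with (u n) in Ht by ring.
    rewrite Cmod_opp in Ht.
    assert (INR k <= INR L) by (apply le_INR; lia).
    assert ((B + Y) * INR k <= (B + Y) * INR L) by (apply Rmult_le_compat_l; lra).
    assert (4 * (B + Y) * INR L <= A * INR L)
      by (apply Rmult_le_compat_r; unfold A; lra).
    nra. }
  (* (1/2)^(1-alpha) >= 1/2, since 0 < alpha < 1. *)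
  assert (Hpow : Rpower r (1 - alpha) / 2 <= Rpower (r / 2) (1 - alpha)).
  { unfold Rdiv. rewrite <- Rpower_mult_distr by lra.
    apply Rmult_le_compat_l; [apply Rlt_le, exp_pos|].
    unfold Rpower. rewrite ln_Rinv by lra.
    rewrite <- (exp_ln (/ 2)) by lra. rewrite ln_Rinv by lra.
    pose proof ln_lt_2. 
    destruct (Rle_lt_or_eq_dec (- ln 2) ((1 - alpha) * - ln 2)) as [h|h];
      [nra | left; apply exp_increasing; exact h | right; f_equal; exact h]. }
  pose proof (block_descent u F p B (K * INR L) (Rpower r (1 - alpha) / 2) n L
                Hn Hrec HF (fun k h => Hsum' n k Hn h)) as Hdesc.
  specialize (Hdesc ltac:(
    intros k Hk; specialize (Hhalf k Hk);
    eapply Rle_trans; [apply Hin; [lia | unfold A in HAr1; lra] |];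
    apply Ropp_le_contravar; eapply Rle_trans; [exact Hpow |];
    apply Rle_Rpower_l; lra)).
  specialize (Hsum n L Hn HL).
  set (q := K * Rpower (INR L) (1 - gamma)) in *.
  (* The equality 4 K r^alpha = L^gamma, in the form that balances the gain over
     the block against the cost of adding back its sum of p. *)
  assert (Hq : Rpower r (1 - alpha) * INR L = 4 * r * q).
  { apply Rmult_eq_reg_r with (Rpower (INR L) gamma); [|lra].
    replace (Rpower r (1 - alpha) * INR L * Rpower (INR L) gamma)
      with (INR L * (Rpower r (1 - alpha) * Rpower (INR L) gamma)) by ring.
    rewrite Hr1a. unfold q.
    replace (4 * r * (K * Rpower (INR L) (1 - gamma)) * Rpower (INR L) gamma)
      with (4 * r * K * (Rpower (INR L) (1 - gamma) * Rpower (INR L) gamma)) by ring.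
    rewrite <- Rpower_plus. replace (1 - gamma + gamma) with 1 by ring.
    rewrite Rpower_1 by lra. ring. }
  assert (Hw : Cmod (u (n + L)%nat - sum_n_m p n (n + L - 1))%C ^ 2
                 <= r ^ 2 - 2 * r * q).
  { eapply Rle_trans; [exact Hdesc|].
    pose proof (Cmod_ge_0 (u n)).
    assert (Cmod (u n) ^ 2 <= r ^ 2) by nra.
    assert (INR L * (Rpower r (1 - alpha) / 2)
            <= INR L * (2 * (Rpower r (1 - alpha) / 2) - 2 * B * (K * INR L) - B ^ 2))
      by (apply Rmult_le_compat_l; lra).
    lra. }
  set (w := (u (n + L)%nat - sum_n_m p n (n + L - 1))%C) in *.
  replace (u (n + L)%nat) with (w + sum_n_m p n (n + L - 1))%C by (unfold w; ring).
  eapply Rle_trans; [apply Cmod_triangle|].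
  pose proof (Cmod_ge_0 w).
  assert (Hqr : 2 * q <= r) by (apply Rmult_le_reg_l with r; nra).
  (* r^2 - 2 r q <= (r - q)^2, and r - q >= 0. *)
  assert (Cmod w <= r - q) by nra.
  lra.
Qed.

(** * The rotated recurrence *)

Theorem theorem5p1 :
  forall (phi : R) (g : R -> R) (alpha M : R) (f : C -> C)
         (y : nat -> C) (K gamma : R),
    0 <= phi < 1 ->
    irrational phi ->
    bounded_on_pos g ->
    0 < alpha ->
    0 < M ->
    (forall t : R, M <= t -> g t = Rpower t (- alpha)) ->
    bounded_fun f ->
    (forall z : C, 0 < Cmod z ->
       Re (f z * e (- phi) * (Cconj z / RtoC (Cmod z)))%C = - g (Cmod z)) ->
    bounded_seq y ->
    0 < K ->
    0 < gamma ->
    (forall n1 n2 : nat, (1 <= n1)%nat -> (n1 < n2)%nat ->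
       Cmod (sum_n_m (fun n : nat => (y n * e (- (INR n * phi)))%C) n1 (n2 - 1))
         <= K * Rpower (INR (n2 - n1)) (1 - gamma)) ->
    alpha * (1 + 1 / gamma) < 1 ->
    forall (x1 : C) (x : nat -> C),
      x 1%nat = x1 ->
      is_solution phi f y x ->
      bounded_seq x.
Proof.
  intros phi g alpha M f y K gamma _ _ _ Ha HM Hg [B HB] Hf [Y HY] HK Hgam Hsum Hag
    x1 x _ Hsol.
  set (rot := fun n : nat => e (- (INR n * phi))).
  assert (Hrot : forall n, Cmod (rot n) = 1) by (intros n; apply Cmod_e).
  assert (Hrot1 : forall n, Cconj (rot n) = e (INR n * phi)).
  { intros n. unfold rot. rewrite <- e_opp. f_equal. ring. }
  assert (HrotS : forall n, rot (S n) = (e (- phi) * rot n)%C).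
  { intros n. unfold rot. rewrite <- e_add, S_INR. f_equal. ring. }
  assert (Hmod : forall n, Cmod (rot n * x n)%C = Cmod (x n)).
  { intros n. rewrite Cmod_mult, Hrot. ring. }
  assert (Hu : bounded_seq (fun n => rot n * x n)%C).
  { apply (bounded_of_inward_drift _
             (fun n => e (- phi) * rot n * f (x n))%C
             (fun n => e (- phi) * (y n * rot n))%C
             B Y M alpha K gamma); auto.
    - intros n Hn. rewrite Hsol, HrotS by lia.
      transitivity ((e (- phi) * e phi) * (rot n * x n)
                    + e (- phi) * rot n * f (x n) + e (- phi) * (y n * rot n))%C.
      + ring.
      + rewrite e_opp_l. ring.
    - intros n. rewrite !Cmod_mult, Hrot, Cmod_e. specialize (HB (x n)). lra.
    - intros n Hn. rewrite !Cmod_mult, Hrot, Cmod_e. specialize (HY n Hn). lra.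
    - intros n Hn. rewrite Hmod. intros HMn.
      assert (Hpos : 0 < Cmod (x n)) by lra.
      specialize (Hf (x n) Hpos). rewrite Hg in Hf by exact HMn.
      assert (Hne : RtoC (Cmod (x n)) <> 0%C).
      { intros h. apply RtoC_inj in h. lra. }
      replace (e (- phi) * rot n * f (x n) * Cconj (rot n * x n))%C
        with (RtoC (Cmod (x n))
              * (f (x n) * e (- phi) * (Cconj (x n) / RtoC (Cmod (x n)))))%C.
      2:{ rewrite Cmult_conj, Hrot1.
          transitivity (e (- phi) * (rot n * e (INR n * phi)) * f (x n) * Cconj (x n))%C.
          - unfold rot. rewrite e_opp_l. field. exact Hne.
          - ring. }
      rewrite re_scal_l, Hf.
      replace (1 - alpha) with (1 + - alpha) by ring.
      rewrite Rpower_plus, Rpower_1 by exact Hpos. lra.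
    - intros n k Hn Hk.
      rewrite (sum_n_m_mult_l (K := C_Ring) (e (- phi)) (fun n => y n * rot n)%C).
      change (@mult C_Ring) with Cmult.
      rewrite Cmod_mult, Cmod_e, Rmult_1_l.
      replace k with (n + k - n)%nat at 2 by lia.
      apply Hsum; lia. }
  destruct Hu as [b Hb]. exists b. intros n Hn. rewrite <- Hmod. apply Hb, Hn.
Qed.
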